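(* Let $d\ge3$ and $q\in(0,1)$. Then the quantum group $SU_q(d)$ (i.e. the augmented algebra $(\mathrm{Pol}(SU_q(d)),\epsilon)$) does not have property (GC).
   Context: $\mathrm{Pol}(SU_q(d))$ is the universal unital $^*$-algebra generated by $u_{jk}$, $1\le j,k\le d$, subject to: $u=(u_{jk})$ is unitary ($uu^*=u^*u=I$), and for every permutation $\tau\in S_d$, $$\sum_{\sigma\in S_d}(-q)^{i(\sigma)}u_{\sigma(1),\tau(1)}u_{\sigma(2),\tau(2)}\cdots u_{\sigma(d),\tau(d)}=(-q)^{i(\tau)}1,$$ where $i(\cdot)$ is the number of inversions. Its character (counit) $\epsilon$ is the unital $^*$-homomorphism to $\mathbb{C}$ with $\epsilon(u_{jk})=\delta_{jk}$. For a unital $^*$-algebra $A$ with a character $\epsilon$: a Gaussian cocycle is a linear map $\eta:A\to H$ into a Hilbert space with $\eta(ab)=\epsilon(a)\eta(b)+\eta(a)\epsilon(b)$ for all $a,b\in A$. It can be completed to a Schürmann triple $(\epsilon(\cdot)\mathrm{id},\eta,\psi)$ if there is a linear functional $\psi:A\to\mathbb{C}$ with $\psi(ab)=\psi(a)\epsilon(b)+\epsilon(a)\psi(b)+\langle\eta(a^* ),\eta(b)\rangle$ for all $a,b\in A$ (inner product linear in the second argument). Property (GC): every Gaussian cocycle $\eta:A\to H$ (any Hilbert space $H$) can be completed to a Schürmann triple. *)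

(* Defs.v *)
From HB Require Import structures.
From mathcomp Require Import all_boot all_order all_algebra.
From mathcomp Require Import perm complex.
From mathcomp Require Import boolp classical_sets reals.
From mathcomp Require Import topology normedtype.

Set Implicit Arguments.
Unset Strict Implicit.
Unset Printing Implicit Defensive.

Import GRing.Theory numFieldNormedType.Exports.

Local Open Scope ring_scope.
Local Open Scope quotient_scope.

(* Unital *-algebras over the complex numbers R[i].  The library's algType
   excludes the zero ring.  Nothing is lost: Pol(SU_q(d)) has a character, and
   the zero algebra receives a unique map from every algebra. *)

HB.mixin Record Algebra_isStar (R : realType) A of GRing.Algebra R[i] A := {
  star : A -> A;
  starK : forall a, star (star a) = a;
  starD : forall a b, star (a + b) = star a + star b;
  starZ : forall (c : R[i]) a, star (c *: a) = conjc c *: star a;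
  starM : forall a b, star (a * b) = star b * star a
}.

#[short(type="starAlgType")]
HB.structure Definition StarAlgebra (R : realType) :=
  {A of GRing.Algebra R[i] A & Algebra_isStar R A}.

Section ComplexStarAlgebra.
Variable R : realType.

Let conjcD' (a b : R[i]) : conjc (a + b) = conjc a + conjc b.
Proof. exact: rmorphD. Qed.

Let conjcZ' (c a : R[i]) : conjc (c *: a) = conjc c *: conjc a.
Proof. exact: rmorphM. Qed.

Let conjcM' (a b : R[i]) : conjc (a * b) = conjc b * conjc a.
Proof. by rewrite mulrC rmorphM. Qed.

HB.instance Definition _ := GRing.Lalgebra_isComAlgebra.Build R[i] R[i].

HB.instance Definition _ :=
  Algebra_isStar.Build R R[i] (@conjcK R) conjcD' conjcZ' conjcM'.
End ComplexStarAlgebra.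

Record starHom (R : realType) (A B : starAlgType R) := StarHom {
  starhom_fun :> {lrmorphism A -> B};
  starhom_star : forall a, starhom_fun (star a) = star (starhom_fun a)
}.

Definition character (R : realType) (A : starAlgType R) := starHom A R[i].

(* The inner product is linear in its second argument.  The field inner_norm
   makes the form positive definite and ties it to the complete norm. *)
HB.mixin Record NormedModule_isHilbert (R : realType) H
    of CompleteNormedModule R[i] H := {
  inner : H -> H -> R[i];
  innerPr : forall (x : H) (c : R[i]) (y z : H),
    inner x (c *: y + z) = c * inner x y + inner x z;
  innerC : forall x y : H, inner x y = conjc (inner y x);
  inner_norm : forall x : H, inner x x = `|x| ^+ 2
}.

#[short(type="hilbertType")]
HB.structure Definition Hilbert (R : realType) :=
  {H of CompleteNormedModule R[i] H & NormedModule_isHilbert R H}.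

Section GaussianCocycles.
Variables (R : realType) (A : starAlgType R) (eps : character A).

Definition gaussian_cocycle (H : hilbertType R) (eta : {linear A -> H}) : Prop :=
  forall a b : A, eta (a * b) = eps a *: eta b + eps b *: eta a.

(* psi completes eta to the Schürmann triple (eps(.) id, eta, psi). *)
Definition schurmann_triple (H : hilbertType R) (eta : {linear A -> H})
    (psi : {scalar A}) : Prop :=
  forall a b : A,
    psi (a * b) = psi a * eps b + eps a * psi b + inner (eta (star a)) (eta b).

Definition property_GC : Prop :=
  forall (H : hilbertType R) (eta : {linear A -> H}),
    gaussian_cocycle eta -> exists psi : {scalar A}, schurmann_triple eta psi.

End GaussianCocycles.

Definition inversions (d : nat) (s : 'S_d) : nat :=
  #|[set p : 'I_d * 'I_d | (p.1 < p.2)%N && (s p.2 < s p.1)%N]|.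

Section SUqRelations.
Variables (R : realType) (d : nat) (q : R).

Definition adjoint_mx (B : starAlgType R) (v : 'M[B]_d) : 'M[B]_d :=
  \matrix_(j, k) star (v k j).

Definition SUq_relations (B : starAlgType R) (v : 'M[B]_d) : Prop :=
  [/\ v *m adjoint_mx v = 1%:M,
      adjoint_mx v *m v = 1%:M
    & forall tau : 'S_d,
        \sum_(sigma : 'S_d)
           (- q%:C%C) ^+ inversions sigma *: \prod_(k < d) v (sigma k) (tau k)
        = (- q%:C%C) ^+ inversions tau *: 1].

End SUqRelations.

(* Pol(SU_q(d)) is the quotient of the formal *-polynomials in d^2 variables by
   the identities that hold for every family satisfying SUq_relations in every
   unital *-algebra.  SUq_gen_relations, SUq_lift, SUq_lift_gen and
   SUq_lift_unique below are its universal property. *)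

Inductive starTerm (R : realType) (d : nat) : Type :=
  | TVar of 'I_d & 'I_d
  | TOne
  | TAdd of starTerm R d & starTerm R d
  | TMul of starTerm R d & starTerm R d
  | TScale of R[i] & starTerm R d
  | TStar of starTerm R d.

Arguments TVar {R d}.
Arguments TOne {R d}.

HB.instance Definition _ R d := gen_eqMixin (starTerm R d).
HB.instance Definition _ R d := gen_choiceMixin (starTerm R d).

Section TermEval.
Variables (R : realType) (d : nat) (B : starAlgType R) (v : 'M[B]_d).

Fixpoint teval (t : starTerm R d) : B :=
  match t with
  | TVar j k => v j k
  | TOne => 1
  | TAdd s t => teval s + teval t
  | TMul s t => teval s * teval t
  | TScale c t => c *: teval t
  | TStar t => star (teval t)
  end.

End TermEval.

Section PolSUq.
Variables (R : realType) (d : nat) (q : R).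

Definition SUq_equiv : rel (starTerm R d) := fun s t =>
  `[< forall (B : starAlgType R) (v : 'M[B]_d),
        SUq_relations q v -> teval v s = teval v t >].

Fact SUq_equiv_refl : reflexive SUq_equiv.
Proof. by move=> t; apply/asboolP. Qed.

Fact SUq_equiv_sym : symmetric SUq_equiv.
Proof. by move=> s t; apply/asboolP/asboolP => h B v hv; rewrite h. Qed.

Fact SUq_equiv_trans : transitive SUq_equiv.
Proof.
move=> t s u /asboolP h1 /asboolP h2; apply/asboolP => B v hv.
by rewrite h1 // h2.
Qed.

Canonical SUq_equiv_equiv :=
  EquivRel SUq_equiv SUq_equiv_refl SUq_equiv_sym SUq_equiv_trans.

Definition PolSUq : Type := {eq_quot SUq_equiv}.

HB.instance Definition _ := Choice.on PolSUq.
HB.instance Definition _ := Quotient.on PolSUq.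

Implicit Types x y z : PolSUq.

Definition SUq_class (t : starTerm R d) : PolSUq := \pi_PolSUq t.

Definition SUq_eval (B : starAlgType R) (v : 'M[B]_d) x : B := teval v (repr x).

Fact SUq_evalE (B : starAlgType R) (v : 'M[B]_d) (t : starTerm R d) :
  SUq_relations q v -> SUq_eval v (SUq_class t) = teval v t.
Proof.
move=> hv; have : repr (SUq_class t) = t %[mod {eq_quot SUq_equiv}] by rewrite reprK.
by move/eqmodP/asboolP => /(_ B v hv).
Qed.

Fact SUq_counit_relations : SUq_relations q (1%:M : 'M[R[i]]_d).
Proof.
have adj1 : adjoint_mx (1%:M : 'M[R[i]]_d) = 1%:M.
  by apply/matrixP => j k; rewrite !mxE eq_sym; exact: conjc_nat.
split; rewrite ?adj1 ?mulmx1 // => tau.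
rewrite (bigD1 tau) //= [X in _ + X]big1 ?addr0 => [|sigma neq].
  by rewrite big1 // => k _; rewrite mxE eqxx.
have [k kneq] : exists k, sigma k != tau k.
  apply/existsP; rewrite -negb_forall; apply: contra neq => /forallP eq_st.
  by apply/eqP/permP => k; exact/eqP.
by rewrite (bigD1 k) //= mxE (negPf kneq) mul0r scaler0.
Qed.

Fact SUq_ext x y :
  (forall (B : starAlgType R) (v : 'M[B]_d),
     SUq_relations q v -> SUq_eval v x = SUq_eval v y) -> x = y.
Proof.
move=> h; rewrite -[x]reprK -[y]reprK; apply/eqmodP/asboolP => B v hv.
exact: h.
Qed.

Definition SUq_add x y := SUq_class (TAdd (repr x) (repr y)).
Definition SUq_zero := SUq_class (TScale 0 TOne).
Definition SUq_opp x := SUq_class (TScale (-1) (repr x)).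
Definition SUq_one := SUq_class TOne.
Definition SUq_mul x y := SUq_class (TMul (repr x) (repr y)).
Definition SUq_scale (c : R[i]) x := SUq_class (TScale c (repr x)).
Definition SUq_star x := SUq_class (TStar (repr x)).

Section Val.
Variables (B : starAlgType R) (v : 'M[B]_d) (hv : SUq_relations q v).

Fact SUq_eval_add x y : SUq_eval v (SUq_add x y) = SUq_eval v x + SUq_eval v y.
Proof. by rewrite SUq_evalE. Qed.
Fact SUq_eval_zero : SUq_eval v SUq_zero = 0.
Proof. by rewrite SUq_evalE //= scale0r. Qed.
Fact SUq_eval_opp x : SUq_eval v (SUq_opp x) = - SUq_eval v x.
Proof. by rewrite SUq_evalE //= scaleN1r. Qed.
Fact SUq_eval_one : SUq_eval v SUq_one = 1.
Proof. by rewrite SUq_evalE. Qed.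
Fact SUq_eval_mul x y : SUq_eval v (SUq_mul x y) = SUq_eval v x * SUq_eval v y.
Proof. by rewrite SUq_evalE. Qed.
Fact SUq_eval_scale c x : SUq_eval v (SUq_scale c x) = c *: SUq_eval v x.
Proof. by rewrite SUq_evalE. Qed.
Fact SUq_eval_star x : SUq_eval v (SUq_star x) = star (SUq_eval v x).
Proof. by rewrite SUq_evalE. Qed.

Definition SUq_evals :=
  (SUq_eval_add, SUq_eval_zero, SUq_eval_opp, SUq_eval_one, SUq_eval_mul,
   SUq_eval_scale, SUq_eval_star).
End Val.

Fact SUq_addA : associative SUq_add.
Proof. by move=> x y z; apply: SUq_ext => B v hv; rewrite !SUq_evals // addrA. Qed.
Fact SUq_addC : commutative SUq_add.
Proof. by move=> x y; apply: SUq_ext => B v hv; rewrite !SUq_evals // addrC. Qed.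
Fact SUq_add0 : left_id SUq_zero SUq_add.
Proof. by move=> x; apply: SUq_ext => B v hv; rewrite !SUq_evals // add0r. Qed.
Fact SUq_addN : left_inverse SUq_zero SUq_opp SUq_add.
Proof. by move=> x; apply: SUq_ext => B v hv; rewrite !SUq_evals // addNr. Qed.

HB.instance Definition _ := GRing.isZmodule.Build PolSUq SUq_addA SUq_addC SUq_add0 SUq_addN.

Fact SUq_one_neq0 : SUq_one != 0.
Proof.
apply/eqP => /(congr1 (SUq_eval (1%:M : 'M[R[i]]_d))).
rewrite !SUq_evals //; first exact/eqP/oner_neq0.
all: exact: SUq_counit_relations.
Qed.

Fact SUq_mulA : associative SUq_mul.
Proof. by move=> x y z; apply: SUq_ext => B v hv; rewrite !SUq_evals // mulrA. Qed.
Fact SUq_mul1l : left_id SUq_one SUq_mul.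
Proof. by move=> x; apply: SUq_ext => B v hv; rewrite !SUq_evals // mul1r. Qed.
Fact SUq_mul1r : right_id SUq_one SUq_mul.
Proof. by move=> x; apply: SUq_ext => B v hv; rewrite !SUq_evals // mulr1. Qed.
Fact SUq_mulDl : left_distributive SUq_mul +%R.
Proof. by move=> x y z; apply: SUq_ext => B v hv; rewrite !SUq_evals // mulrDl. Qed.
Fact SUq_mulDr : right_distributive SUq_mul +%R.
Proof. by move=> x y z; apply: SUq_ext => B v hv; rewrite !SUq_evals // mulrDr. Qed.

HB.instance Definition _ :=
  GRing.Zmodule_isNzRing.Build PolSUq
    SUq_mulA SUq_mul1l SUq_mul1r SUq_mulDl SUq_mulDr SUq_one_neq0.

Fact SUq_scaleA a b x : SUq_scale a (SUq_scale b x) = SUq_scale (a * b) x.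
Proof. by apply: SUq_ext => B v hv; rewrite !SUq_evals // scalerA. Qed.
Fact SUq_scale1 : left_id 1 SUq_scale.
Proof. by move=> x; apply: SUq_ext => B v hv; rewrite !SUq_evals // scale1r. Qed.
Fact SUq_scaleDr : right_distributive SUq_scale +%R.
Proof. by move=> c x y; apply: SUq_ext => B v hv; rewrite !SUq_evals // scalerDr. Qed.
Fact SUq_scaleDl x : {morph SUq_scale^~ x : a b / a + b}.
Proof. by move=> a b; apply: SUq_ext => B v hv; rewrite !SUq_evals // scalerDl. Qed.

HB.instance Definition _ :=
  GRing.Zmodule_isLmodule.Build R[i] PolSUq SUq_scaleA SUq_scale1 SUq_scaleDr SUq_scaleDl.

Fact SUq_scaleAl (c : R[i]) x y : c *: (x * y) = (c *: x) * y.
Proof. by apply: SUq_ext => B v hv; rewrite !SUq_evals // scalerAl. Qed.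
Fact SUq_scaleAr (c : R[i]) x y : c *: (x * y) = x * (c *: y).
Proof. by apply: SUq_ext => B v hv; rewrite !SUq_evals // scalerAr. Qed.

HB.instance Definition _ :=
  GRing.Lmodule_isLalgebra.Build R[i] PolSUq SUq_scaleAl.
HB.instance Definition _ :=
  GRing.Lalgebra_isAlgebra.Build R[i] PolSUq SUq_scaleAr.

Fact SUq_starK x : SUq_star (SUq_star x) = x.
Proof. by apply: SUq_ext => B v hv; rewrite !SUq_evals // starK. Qed.
Fact SUq_starD x y : SUq_star (x + y) = SUq_star x + SUq_star y.
Proof. by apply: SUq_ext => B v hv; rewrite !SUq_evals // starD. Qed.
Fact SUq_starZ (c : R[i]) x : SUq_star (c *: x) = conjc c *: SUq_star x.
Proof. by apply: SUq_ext => B v hv; rewrite !SUq_evals // starZ. Qed.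
Fact SUq_starM x y : SUq_star (x * y) = SUq_star y * SUq_star x.
Proof. by apply: SUq_ext => B v hv; rewrite !SUq_evals // starM. Qed.

HB.instance Definition _ :=
  Algebra_isStar.Build R PolSUq SUq_starK SUq_starD SUq_starZ SUq_starM.

Definition SUq_gen : 'M[PolSUq]_d := \matrix_(j, k) SUq_class (TVar j k).

Section Lift.
Variables (B : starAlgType R) (v : 'M[B]_d) (hv : SUq_relations q v).

Definition SUq_lift_fun x : B := teval v (repr x).

Fact SUq_lift_linear (c : R[i]) x y :
  SUq_lift_fun (c *: x + y) = c *: SUq_lift_fun x + SUq_lift_fun y.
Proof. by rewrite [LHS]SUq_evals // SUq_evals. Qed.

Fact SUq_lift_monoid : monoid_morphism SUq_lift_fun.
Proof. by split=> [|x y]; [exact: SUq_eval_one | exact: SUq_eval_mul]. Qed.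

HB.instance Definition _ :=
  GRing.isLinear.Build R[i] PolSUq B *:%R SUq_lift_fun SUq_lift_linear.
HB.instance Definition _ :=
  GRing.isMonoidMorphism.Build PolSUq B SUq_lift_fun SUq_lift_monoid.

Fact SUq_lift_star x : SUq_lift_fun (star x) = star (SUq_lift_fun x).
Proof. exact: SUq_eval_star. Qed.

Definition SUq_lift : starHom PolSUq B :=
  @StarHom R PolSUq B SUq_lift_fun SUq_lift_star.

Lemma SUq_lift_gen j k : SUq_lift (SUq_gen j k) = v j k.
Proof. by rewrite mxE; exact: SUq_evalE. Qed.

End Lift.

Lemma SUq_gen_relations : SUq_relations q SUq_gen.
Proof.
have liftP (B : starAlgType R) (v : 'M[B]_d) : SUq_relations q v ->
    exists2 f : starHom PolSUq B,
      f =1 SUq_eval v & forall j k, f (SUq_gen j k) = v j k.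
  by move=> hv; exists (SUq_lift hv) => // j k; exact: SUq_lift_gen.
split=> [||tau].
- apply/matrixP => j k; apply: SUq_ext => B v hv; have [f fE fgen] := liftP _ _ hv.
  have [/matrixP/(_ j k) + _ _] := hv; rewrite -!fE !mxE => vE.
  rewrite rmorph_sum rmorph_nat -vE; apply: eq_bigr => i _.
  by rewrite !(@mxE _ _ _ _ (fun _ _ => star _)) rmorphM /= starhom_star !fgen.
- apply/matrixP => j k; apply: SUq_ext => B v hv; have [f fE fgen] := liftP _ _ hv.
  have [_ /matrixP/(_ j k) + _] := hv; rewrite -!fE !mxE => vE.
  rewrite rmorph_sum rmorph_nat -vE; apply: eq_bigr => i _.
  by rewrite !(@mxE _ _ _ _ (fun _ _ => star _)) rmorphM /= starhom_star !fgen.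
- apply: SUq_ext => B v hv; have [f fE fgen] := liftP _ _ hv.
  have [_ _ /(_ tau) vE] := hv; rewrite -!fE.
  rewrite linear_sum linearZ /= rmorph1 -vE; apply: eq_bigr => sigma _.
  rewrite linearZ /= rmorph_prod; congr (_ *: _); apply: eq_bigr => i _.
  exact: fgen.
Qed.

Lemma SUq_lift_unique (B : starAlgType R) (f g : starHom PolSUq B) :
  (forall j k, f (SUq_gen j k) = g (SUq_gen j k)) -> f =1 g.
Proof.
move=> fg x; rewrite -[x]reprK; elim: (repr x) => {x}.
- by move=> j k; have := fg j k; rewrite !mxE.
- by rewrite -[\pi_PolSUq _]/(1 : PolSUq) !rmorph1.
- move=> s IHs t IHt.
  have -> : \pi_PolSUq (TAdd s t) = \pi_PolSUq s + \pi_PolSUq t.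
    by apply: SUq_ext => B' v hv; rewrite SUq_evals // !SUq_evalE.
  by rewrite !rmorphD /= IHs IHt.
- move=> s IHs t IHt.
  have -> : \pi_PolSUq (TMul s t) = \pi_PolSUq s * \pi_PolSUq t.
    by apply: SUq_ext => B' v hv; rewrite SUq_evals // !SUq_evalE.
  by rewrite !rmorphM /= IHs IHt.
- move=> c s IHs.
  have -> : \pi_PolSUq (TScale c s) = c *: \pi_PolSUq s.
    by apply: SUq_ext => B' v hv; rewrite SUq_evals // !SUq_evalE.
  by rewrite !linearZ /= IHs.
- move=> s IHs.
  have -> : \pi_PolSUq (TStar s) = star (\pi_PolSUq s).
    by apply: SUq_ext => B' v hv; rewrite SUq_evals // !SUq_evalE.
  by rewrite !starhom_star IHs.
Qed.

Definition SUq_counit : character PolSUq := SUq_lift SUq_counit_relations.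

Lemma SUq_counit_gen j k : SUq_counit (SUq_gen j k) = (j == k)%:R.
Proof. by rewrite SUq_lift_gen mxE. Qed.

End PolSUq.

(* Main.v *)
(* If (eps id, eta, psi) is a Schürmann triple and eta(u_jk) = eta(u_jk^* ) = 0
   for j <> k, then psi kills every monomial of the twisted determinant with
   sigma <> tau, since such a monomial has two off-diagonal factors.  So the
   determinant relation gives psi(u_{tau(1),tau(1)} ... u_{tau(d),tau(d)}) = 0
   for every tau.  Comparing the identity with a transposition yields
   <eta(u_11^* ), eta(u_22)> = <eta(u_22^* ), eta(u_11)>.  This fails for the
   cocycle with values in C given by eta(u_kk) = h_k, h = (1, i, -1-i, 0, ...),
   where d >= 3 makes room for sum h_k = 0. *)

Require Import Defs.
From HB Require Import structures.
From mathcomp Require Import all_boot all_order all_algebra.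
From mathcomp Require Import perm complex reals boolp classical_sets filter topology normedtype.
From mathcomp Require Import ring lra.
Set Implicit Arguments.
Unset Strict Implicit.
Unset Printing Implicit Defensive.

Import Order.TTheory GRing.Theory Num.Theory numFieldNormedType.Exports.

Local Open Scope ring_scope.

(** * The complex line as a Hilbert space *)

Section ComplexHilbert.
Variable R : realType.

(** A 1-Lipschitz map preserves Cauchy filters, so completeness of the reals applies. It is used for
    real and imaginary parts. *)
Lemma cauchy_cvg_lipschitz (F : set_system R[i]^o) (f : R[i] -> R) :
  (forall x y, `|f x - f y|%:C%C <= `|x - y|) ->
  ProperFilter F -> cauchy F -> cvg (f @ F)%classic.
Proof.
move=> lipf FF /cauchy_ballP cF; apply: cauchy_cvg; apply/cauchy_ballP => e e0.
have e0' : 0 < e%:C%C :> R[i] by rewrite ltcR.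
rewrite near_map2; apply: filterS (cF _ e0') => -[x y] /=.
rewrite -!ball_normE /= => h.
by rewrite -ltcR (le_lt_trans (lipf _ _)).
Qed.

Lemma normc_ge_Im (x : R[i]) : `|complex.Im x|%:C%C <= `|x|.
Proof.
by case: x => a b; rewrite normc_def lecR /= -sqrtr_sqr ler_wsqrtr // lerDr sqr_ge0.
Qed.

Lemma normc_le_ReIm (x : R[i]) :
  `|x| <= (`|complex.Re x| + `|complex.Im x|)%:C%C.
Proof.
rewrite normc_def lecR -[leRHS]ger0_norm ?addr_ge0 // -sqrtr_sqr ler_wsqrtr //.
by rewrite sqrrD !real_normK ?num_real // -addrA addrCA lerDr mulrn_wge0 ?mulr_ge0.
Qed.

Lemma complex_complete (F : set_system R[i]^o) :
  ProperFilter F -> cauchy F -> cvg F.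
Proof.
move=> FF cF.
have /cvg_ex[a /cvgrPdist_lt Fa] : cvg (@complex.Re R @ F)%classic.
  by apply: cauchy_cvg_lipschitz => // x y; rewrite -raddfB normc_ge_Re.
have /cvg_ex[b /cvgrPdist_lt Fb] : cvg (@complex.Im R @ F)%classic.
  by apply: cauchy_cvg_lipschitz => // x y; rewrite -raddfB normc_ge_Im.
apply/cvg_ex; exists (a +i* b)%C; apply/cvgrPdist_lt => e e0.
(* Positive elements of [R[i]] are real, so the radius can be halved in [R]. *)
have [eR0 eE] : 0 < complex.Re e /\ e = (complex.Re e)%:C%C.
  by move: e0; case: e => x y; rewrite ltcE /= => /andP[/eqP-> ->].
have e2 : 0 < complex.Re e / 2 by rewrite divr_gt0.
near=> x; apply: le_lt_trans (normc_le_ReIm _) _.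
rewrite eE ltcR [ltRHS]splitr ltrD //.
- by near: x; apply: filterS (Fa _ e2) => -[].
- by near: x; apply: filterS (Fb _ e2) => -[].
Unshelve. all: by end_near. Qed.

(* The library already declares GRing.regular complete for real scalars, which
   blocks a second canonical instance on R[i]^o. *)
Definition complex_line : Type := R[i]^o.

HB.instance Definition _ := NormedModule.copy complex_line R[i]^o.

HB.instance Definition _ := Uniform_isComplete.Build complex_line complex_complete.

Let inner_linear (x : complex_line) (c : R[i]) (y z : complex_line) :
  conjc x * (c *: y + z) = c * (conjc x * y) + conjc x * z.
Proof. by rewrite mulrDr mulrCA. Qed.

Let inner_conj (x y : complex_line) : conjc x * y = conjc (conjc y * x).
Proof. by rewrite rmorphM /= conjcK mulrC. Qed.

Let inner_sqr (x : complex_line) : conjc x * x = `|x| ^+ 2.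
Proof. by rewrite mulrC -sqr_normc. Qed.

HB.instance Definition _ := NormedModule_isHilbert.Build R complex_line
  inner_linear inner_conj inner_sqr.

End ComplexHilbert.

(** * Target algebra encoding complex-valued Gaussian cocycles *)

Section DoubleDual.
Variable R : realType.

(* For a Gaussian cocycle eta into C, the map a |-> (eps a, (eta a, conj (eta a^* )))
   is a *-homomorphism into C[x, y] / (x, y)^2 with x^* = y; the second
   coordinate is there only to carry the involution. *)
Definition ddual : Type := (R[i] * (R[i] * R[i]))%type.

HB.instance Definition _ := GRing.Lmodule.on ddual.

Implicit Types x y z : ddual.

Let one : ddual := (1, (0, 0)).
Let mul x y : ddual :=
  (x.1 * y.1, (x.1 * y.2.1 + y.1 * x.2.1, x.1 * y.2.2 + y.1 * x.2.2)).

Let mulA : associative mul.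
Proof. by move=> [a [b c]] [a' [b' c']] [a2 [b2 c2]]; congr (_, (_, _)) => /=; ring. Qed.
Let mulC : commutative mul.
Proof. by move=> [a [b c]] [a' [b' c']]; congr (_, (_, _)) => /=; ring. Qed.
Let mul1 : left_id one mul.
Proof. by move=> [a [b c]]; congr (_, (_, _)) => /=; ring. Qed.
Let mulDl : left_distributive mul +%R.
Proof. by move=> [a [b c]] [a' [b' c']] [a2 [b2 c2]]; congr (_, (_, _)) => /=; ring. Qed.
Let one_neq0 : one != 0.
Proof. by apply/eqP => -[] /eqP; rewrite oner_eq0. Qed.

HB.instance Definition _ :=
  GRing.Zmodule_isComNzRing.Build ddual mulA mulC mul1 mulDl one_neq0.

Let scaleAl (c : R[i]) x y : c *: (x * y) = (c *: x : ddual) * y.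
Proof.
have scaleE (a b : R[i]) : a *: b = a * b by [].
by case: x y => [a [b e]] [a1 [b1 e1]]; congr (_, (_, _)); rewrite /= !scaleE; ring.
Qed.

HB.instance Definition _ := GRing.Lmodule_isLalgebra.Build R[i] ddual scaleAl.
HB.instance Definition _ := GRing.Lalgebra_isComAlgebra.Build R[i] ddual.

Let dstar x : ddual := (conjc x.1, (conjc x.2.2, conjc x.2.1)).

Let dstarK x : dstar (dstar x) = x.
Proof. by case: x => [a [b c]]; rewrite /dstar /= !conjcK. Qed.
Let dstarD x y : dstar (x + y) = dstar x + dstar y.
Proof. by congr (_, (_, _)) => /=; rewrite rmorphD. Qed.
Let dstarZ (c : R[i]) x : dstar (c *: x) = conjc c *: dstar x.
Proof. by congr (_, (_, _)); apply: rmorphM. Qed.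
Let dstarM x y : dstar (x * y) = dstar y * dstar x.
Proof. by congr (_, (_, _)); rewrite /= ?rmorphD /= !rmorphM /=; ring. Qed.

HB.instance Definition _ :=
  Algebra_isStar.Build R ddual dstarK dstarD dstarZ dstarM.
End DoubleDual.

(** * Schürmann triples over a Gaussian cocycle on an arbitrary *-algebra *)

Section SchurmannTriples.
Variables (R : realType) (A : starAlgType R) (eps : character A).
Variables (H : hilbertType R) (eta : {linear A -> H}) (psi : {scalar A}).
Hypotheses (etaG : gaussian_cocycle eps eta) (psiP : schurmann_triple eps eta psi).

Let inner0 (x : H) : inner x 0 = 0.
Proof.
have := innerPr x 1 0 0; rewrite scaler0 addr0 mul1r => /eqP.
by rewrite -subr_eq0 opprD addNKr oppr_eq0 => /eqP.
Qed.

Lemma gaussian_cocycle1 : eta 1 = 0.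
Proof.
have := etaG 1 1; rewrite mulr1 rmorph1 scale1r => /eqP.
by rewrite -subr_eq0 opprD addNKr oppr_eq0 => /eqP.
Qed.

Lemma schurmann_triple1 : psi 1 = 0.
Proof.
have := psiP 1 1; rewrite mulr1 rmorph1 gaussian_cocycle1 inner0 mul1r mulr1 addr0.
by move=> /eqP; rewrite -subr_eq0 opprD addNKr oppr_eq0 => /eqP.
Qed.

Let star0 : star (0 : R[i]) = 0. Proof. exact: conjc0. Qed.

(** These elements form a two-sided ideal, and [psi] vanishes on the product of any two of them. *)
Definition cocycle_null (a : A) := [/\ eps a = 0, eta a = 0 & eta (star a) = 0].

Lemma cocycle_nullMl a b : cocycle_null b -> cocycle_null (a * b).
Proof.
case=> eb hb hb'; split.
- by rewrite rmorphM /= eb mulr0.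
- by rewrite etaG eb hb scaler0 scale0r addr0.
by rewrite starM etaG hb' starhom_star eb star0 scale0r scaler0 addr0.
Qed.

Lemma cocycle_nullMr a b : cocycle_null a -> cocycle_null (a * b).
Proof.
case=> ea ha ha'; split.
- by rewrite rmorphM /= ea mul0r.
- by rewrite etaG ea ha scaler0 scale0r addr0.
by rewrite starM etaG ha' (starhom_star eps a) ea star0 scale0r scaler0 addr0.
Qed.

Lemma schurmann_triple_prod0 (I : Type) (s : seq I) (P : pred I) (F : I -> A) :
  (forall i, P i -> cocycle_null (F i)) -> (1 < count P s)%N ->
  psi (\prod_(i <- s) F i) = 0.
Proof.
move=> nullF; have null_prod r : (0 < count P r)%N -> cocycle_null (\prod_(i <- r) F i).
  elim: r => //= i r IH; rewrite big_cons; case Pi: (P i) => /= cnt.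
    exact/cocycle_nullMr/nullF.
  exact/cocycle_nullMl/IH.
elim: s => //= i s IH; rewrite big_cons psiP => cnt.
(* The tail keeps at least one null factor, so only [eps (F i) * psi tail] survives. Either [F i] is
   null and [eps (F i) = 0], or the tail has two null factors and induction applies. *)
have [|er hr _] := null_prod s; first by case: (P i) cnt => // /ltnW.
rewrite er hr inner0 mulr0 add0r addr0; move: cnt.
case Pi: (P i) => cnt; last by rewrite IH // mulr0.
by have [-> _ _] := nullF i Pi; rewrite mul0r.
Qed.

(** In [psi (a * b * c)] all terms but [psi (a * b)] involve [a * b] only through [eps] and through
    [eta] of its adjoint, both symmetric in [a] and [b]. They cancel; so do the terms of
    [psi (a * b)] other than the inner product. *)
Lemma schurmann_triple_swap (a b c : A) : eps c = 1 ->
  psi (a * b * c) = psi (b * a * c) ->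
  inner (eta (star a)) (eta b) = inner (eta (star b)) (eta a).
Proof.
move=> ec; rewrite (psiP (a * b)) (psiP (b * a)) ec !mulr1 !rmorphM !starM !etaG.
rewrite (mulrC (eps b)) (addrC (_ *: eta (star b))) => /addIr /addIr.
rewrite !psiP (mulrC (psi b)) (mulrC (psi a)) [_ + _ * psi a]addrC.
exact: addrI.
Qed.

End SchurmannTriples.

Lemma perm_neq_ex (T : finType) (s t : {perm T}) : s != t -> exists x, s x != t x.
Proof.
move=> neq; apply/existsP; rewrite -negb_forall; apply: contra neq => /forallP eq_st.
by apply/eqP/permP => x; exact/eqP.
Qed.

(** * Symmetry forced by the twisted determinant relations *)

Section SUqTriples.
Variables (R : realType) (n : nat) (q : R).
Let u := SUq_gen n.+2 q.
Variables (H : hilbertType R) (eta : {linear PolSUq n.+2 q -> H}).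
Variable psi : {scalar PolSUq n.+2 q}.
Hypotheses (q_neq0 : q != 0) (etaG : gaussian_cocycle (SUq_counit n.+2 q) eta).
Hypothesis psiP : schurmann_triple (SUq_counit n.+2 q) eta psi.
Hypothesis eta_offdiag : forall j k, j != k -> eta (u j k) = 0 /\ eta (star (u j k)) = 0.

Lemma SUq_psi_diag (tau : 'S_n.+2) : psi (\prod_(k < n.+2) u (tau k) (tau k)) = 0.
Proof.
have [_ _ /(_ tau) /(congr1 psi)] := SUq_gen_relations n.+2 q.
rewrite linear_sum linearZ /= (schurmann_triple1 etaG psiP) mulr0.
rewrite (bigD1 tau) //= [X in _ + X]big1 => [|sigma neq].
  rewrite addr0 linearZ /= => /eqP; rewrite mulf_eq0 => /orP[|/eqP//].
  by rewrite expf_eq0 oppr_eq0 fmorph_eq0 (negPf q_neq0) andbF.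
rewrite linearZ /= (schurmann_triple_prod0 etaG psiP (P := fun k => sigma k != tau k)).
- by rewrite mulr0.
- move=> k neqk; have [h1 h2] := eta_offdiag neqk; split=> //.
  by rewrite SUq_counit_gen (negPf neqk).
have [k neqk] := perm_neq_ex neq.
have : (1 < #|[pred k | sigma k != tau k]|)%N.
  (* Two permutations never differ at one point only: at [k' = tau^-1 (sigma k)], [tau] takes the
     value [sigma k], which [sigma] takes only at [k]. *)
  apply/card_gt1P; exists k, (tau^-1 (sigma k))%g; rewrite !inE permKV neqk; split=> //.
    by apply: contra neqk => /eqP/perm_inj e; rewrite -{2}e permKV.
  by apply: contra neqk => /eqP e; rewrite {2}e permKV.
by rewrite cardE size_filter.
Qed.

Lemma SUq_triple_symmetric :
  inner (eta (star (u ord0 ord0))) (eta (u (lift ord0 ord0) (lift ord0 ord0))) =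
  inner (eta (star (u (lift ord0 ord0) (lift ord0 ord0)))) (eta (u ord0 ord0)).
Proof.
set i0 : 'I_n.+2 := ord0; set i1 : 'I_n.+2 := lift ord0 ord0.
(* The common tail of the diagonal monomials for the identity and for the transposition of the first
   two indices. *)
pose c := \prod_(k < n) u (lift ord0 (lift ord0 k)) (lift ord0 (lift ord0 k)).
apply: (schurmann_triple_swap etaG psiP (c := c)).
  by rewrite rmorph_prod big1 //= => k _; rewrite SUq_counit_gen eqxx.
have := SUq_psi_diag 1; rewrite !big_ord_recl mulrA !perm1 => h1.
have := SUq_psi_diag (tperm i0 i1); rewrite !big_ord_recl mulrA tpermL tpermR => h2.
transitivity (0 : R[i]); [rewrite -h1|rewrite -h2]; congr (psi (_ * _)).
  by apply: eq_bigr => k _; rewrite perm1.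
by apply: eq_bigr => k _; rewrite tpermD.
Qed.

End SUqTriples.

(** * Gaussian cocycles supported on the diagonal generators *)

Section DiagonalCocycle.
Variables (R : realType) (d : nat) (q : R) (h : 'I_d -> R[i]).
Hypothesis sum_h : \sum_k h k = 0.

(** This is exp(a x - conj(a) y) in C[x, y] / (x, y)^2. The exponent is skew-adjoint because x^* =
    y, so the element is unitary, and sums become products. *)
Definition ddual_unit (a : R[i]) : ddual R := (1, (a, - conjc a)).

Let unit0 : ddual_unit 0 = 1.
Proof. by rewrite /ddual_unit conjc0 oppr0. Qed.

Let unitD a b : ddual_unit (a + b) = ddual_unit a * ddual_unit b.
Proof. by congr (_, (_, _)) => /=; rewrite ?rmorphD /=; ring. Qed.

Let unit_star a : star (ddual_unit a) = ddual_unit (- a).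
Proof.
congr (_, (_, _)) => /=; rewrite ?rmorphN /= ?conjcK ?opprK //.
by rewrite oppr0.
Qed.

Definition diag_ddual : 'M[ddual R]_d := diag_mx (\row_k ddual_unit (h k)).

Lemma diag_ddual_relations : SUq_relations q diag_ddual.
Proof.
have adjE : adjoint_mx diag_ddual = diag_mx (\row_k ddual_unit (- h k)).
  apply/matrixP => i j; rewrite !mxE eq_sym.
  case: eqP => [->|_]; rewrite ?mulr0n ?mulr1n ?unit_star //.
  by rewrite /star /=; congr (_, (_, _)); exact: conjc0.
have diag1 (a b : 'I_d -> R[i]) : (forall k, a k + b k = 0) ->
    diag_mx (\row_k ddual_unit (a k)) *m diag_mx (\row_k ddual_unit (b k)) = 1%:M.
  move=> ab; rewrite mulmx_diag -diag_const_mx; congr diag_mx.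
  by apply/rowP => k; rewrite !mxE -unitD ab unit0.
split=> [||tau].
- by rewrite adjE diag1 // => k; rewrite subrr.
- by rewrite adjE diag1 // => k; rewrite addNr.
rewrite (bigD1 tau) //= [X in _ + X]big1 ?addr0 => [|sigma neq].
  congr (_ *: _); under eq_bigr do rewrite !mxE eqxx mulr1n.
  rewrite -(big_morph _ unitD unit0).
  (* The diagonal monomial is the exponential attached to the sum of the [h k], which is zero in any
     order. *)
  by rewrite -(reindex_inj (@perm_inj _ tau) (F := h) (P := xpredT)) /= sum_h unit0.
have [k kneq] := perm_neq_ex neq.
by rewrite (bigD1 k) //= mxE (negPf kneq) mulr0n mul0r scaler0.
Qed.

Let lift_h := SUq_lift diag_ddual_relations.

(** The constant term is packaged as a *-homomorphism so that uniqueness of lifts identifies it with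
    the counit. *)
Let base (x : PolSUq d q) : R[i] := (lift_h x).1.
Let base_linear : linear base.
Proof. by move=> c x y; rewrite /base linearP. Qed.
Let base_monoid : monoid_morphism base.
Proof. by split=> [|x y]; rewrite /base ?rmorph1 ?rmorphM. Qed.
HB.instance Definition _ := GRing.isLinear.Build R[i] _ _ _ base base_linear.
HB.instance Definition _ := GRing.isMonoidMorphism.Build _ _ base base_monoid.
Let base_star x : base (star x) = star (base x).
Proof. by rewrite /base starhom_star. Qed.

Let baseE x : (lift_h x).1 = SUq_counit d q x.
Proof.
apply: (SUq_lift_unique (f := @StarHom R (PolSUq d q) R[i] base base_star)) => j k.
by rewrite SUq_counit_gen /= /base SUq_lift_gen !mxE; case: eqP.
Qed.

Definition diag_cocycle (x : PolSUq d q) : complex_line R := (lift_h x).2.1.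

Let diag_cocycle_linear : linear diag_cocycle.
Proof. by move=> c x y; rewrite /diag_cocycle linearP. Qed.
HB.instance Definition _ :=
  GRing.isLinear.Build R[i] _ _ _ diag_cocycle diag_cocycle_linear.

(** The cocycle identity is the x-coefficient of multiplicativity of [lift_h]. *)
Lemma diag_cocycle_gaussian : gaussian_cocycle (SUq_counit d q) diag_cocycle.
Proof.
by move=> a b; rewrite -!baseE; exact: (congr1 (fun z => z.2.1) (rmorphM lift_h a b)).
Qed.

Lemma diag_cocycle_gen j k :
  diag_cocycle (SUq_gen d q j k) = if j == k then h j else 0.
Proof. by rewrite /diag_cocycle SUq_lift_gen !mxE; case: eqP. Qed.

Lemma diag_cocycle_star_gen j k :
  diag_cocycle (star (SUq_gen d q j k)) = if j == k then - h j else 0.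
Proof.
rewrite /diag_cocycle starhom_star SUq_lift_gen !mxE.
case: eqP => _; last exact: conjc0.
by rewrite mulr1n unit_star.
Qed.

End DiagonalCocycle.

Theorem proposition2p3 (R : realType) (d : nat) (q : R) :
  (3 <= d)%N -> 0 < q < 1 -> ~ property_GC (SUq_counit d q).
Proof.
case: d => [|[|[|n]]] // _ /andP[q_gt0 _] GC.
(* The default value of [nth] supplies the zeros beyond the third entry. *)
pose h (k : 'I_n.+3) : R[i] := nth 0 [:: 1; 'i%C; - 1 - 'i%C] k.
have sum_h : \sum_k h k = 0.
  by rewrite !big_ord_recl big1 => [|i _]; rewrite /h /= ?nth_nil //; ring.
have etaG : gaussian_cocycle (SUq_counit n.+3 q) (diag_cocycle sum_h).
  exact: diag_cocycle_gaussian.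
have [psi psiP] := GC _ _ etaG.
have offdiag j k : j != k -> diag_cocycle sum_h (SUq_gen n.+3 q j k) = 0 /\
    diag_cocycle sum_h (star (SUq_gen n.+3 q j k)) = 0.
  by move=> /negPf jk; rewrite diag_cocycle_gen diag_cocycle_star_gen jk.
have := SUq_triple_symmetric (lt0r_neq0 q_gt0) etaG psiP offdiag.
rewrite /= !diag_cocycle_gen !diag_cocycle_star_gen !eqxx /inner /= /h /=.
(* The two inner products are conj(-1) i = -i and conj(-i) 1 = i. *)
by move=> /(congr1 (@complex.Im R)) /=; lra.
Qed.
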